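(* Let $V$ be an optimal prefix-free machine, and for real $T>0$ let $\Theta_V(T)=\sum_{s\in\{0,1\}^*,\,H_V(s)<|s|}2^{-|s|/T}$. For every $T\in(0,1)$, if $\Theta_V(T)$ is right-computable, then $T$ is weakly Chaitin $T$-random.
   Context: $\{0,1\}^*$ is the set of finite binary strings; $|s|$ is the length of $s$. A prefix-free machine is a partial recursive function $C:\{0,1\}^*\to\{0,1\}^*$ whose domain is prefix-free. $H_C(s)=\min\{|p| : C(p)=s\}$ (possibly $\infty$). A prefix-free machine $U$ is optimal if for every prefix-free machine $C$ there is $d\in\mathbb{N}$ such that for every $p\in\mathrm{Dom}\,C$ there is $q\in\mathrm{Dom}\,U$ with $U(q)=C(p)$ and $|q|\le|p|+d$. A particular optimal prefix-free machine $U$ is fixed and $H(s):=H_U(s)$. For a real $\alpha$ and $n\ge1$, $\alpha\restriction n$ denotes the first $n$ bits of the base-two expansion of $\alpha-\lfloor\alpha\rfloor$ (the expansion with infinitely many zeros). A real $\alpha$ is right-computable if there is a total recursive $f:\mathbb{N}^+\to\mathbb{Q}$ with $\alpha\le f(n)$ for all $n$ and $\lim_n f(n)=\alpha$. For $T\in(0,1]$, $\alpha$ is weakly Chaitin $T$-random if there is $c\in\mathbb{N}$ with $Tn-c\le H(\alpha\restriction n)$ for all $n\in\mathbb{N}^+$. *)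

(* Defs.v *)
From HB Require Import structures.
From mathcomp Require Import all_boot all_order all_algebra.
From mathcomp Require Import all_classical all_reals all_analysis.
Set Implicit Arguments. Unset Strict Implicit. Unset Printing Implicit Defensive.
Import Order.TTheory GRing.Theory Num.Theory.
Import numFieldNormedType.Exports.
Local Open Scope classical_set_scope.
Local Open Scope ring_scope.

(* Arities are not checked: missing arguments read as 0 and extra          *)
(* arguments are ignored; this does not change the class of computable     *)
(* partial functions.                                                      *)
Inductive rcode : Type :=
| cZero : rcode
| cSucc : rcode
| cProj : nat -> rcode
| cComp : rcode -> list rcode -> rcode
| cPrec : rcode -> rcode -> rcode
| cMu   : rcode -> rcode.

Inductive eval : rcode -> seq nat -> nat -> Prop :=
| eZero args : eval cZero args 0
| eSucc args : eval cSucc args (head 0%N args).+1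
| eProj i args : eval (cProj i) args (nth 0%N args i)
| eComp f gs args ys z :
    evals gs args ys -> eval f ys z -> eval (cComp f gs) args z
| ePrec0 f g args z : eval f args z -> eval (cPrec f g) (0%N :: args) z
| ePrecS f g n args y z :
    eval (cPrec f g) (n :: args) y -> eval g (n :: y :: args) z ->
    eval (cPrec f g) (n.+1 :: args) z
| eMu f args n :
    eval f (n :: args) 0 ->
    (forall m, (m < n)%N -> exists k, eval f (m :: args) k.+1) ->
    eval (cMu f) args n
with evals : list rcode -> seq nat -> seq nat -> Prop :=
| esNil args : evals [::] args [::]
| esCons g gs args y ys :
    eval g args y -> evals gs args ys -> evals (g :: gs) args (y :: ys).

(* Binary strings are seq bool. Bijective coding {0,1}^* -> nat:
   s |-> (the number with binary expansion 1s) - 1. *)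
Definition str_code (s : seq bool) : nat :=
  (foldl (fun n (b : bool) => n.*2 + b) 1 s).-1.

(* Computable surjective decoding nat -> rat:
   m+1 = 2^a (2b+1) |-> zig(a) / (b+1). *)
Definition zig (a : nat) : int :=
  if odd a then - ((a.+1)./2)%:Z else (a./2)%:Z.
Definition rat_decode (m : nat) : rat :=
  let a := logn 2 m.+1 in
  let b := ((m.+1 %/ 2 ^ a)./2)%N in
  (zig a)%:~R / (b.+1)%:R.

Definition pfun := seq bool -> option (seq bool).

Definition partial_recursive (C : pfun) : Prop :=
  exists c : rcode, forall p y : seq bool,
    C p = Some y <-> eval c [:: str_code p] (str_code y).

Definition dom (C : pfun) : set (seq bool) := [set p | C p <> None].

Definition prefix_free_set (D : set (seq bool)) : Prop :=
  forall p q, D p -> D q -> prefix p q -> p = q.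

Definition prefix_free_machine (C : pfun) : Prop :=
  partial_recursive C /\ prefix_free_set (dom C).

Definition HC {R : realType} (C : pfun) (s : seq bool) : \bar R :=
  ereal_inf [set ((size p)%:R)%:E | p in [set p | C p = Some s]].

Definition optimal (U : pfun) : Prop :=
  prefix_free_machine U /\
  forall C : pfun, prefix_free_machine C ->
    exists d : nat, forall p, dom C p ->
      exists q, dom U q /\ U q = C p /\ (size q <= size p + d)%N.

(* alpha restricted to n: first n bits of the base-two expansion of
   alpha - floor alpha (the expansion with infinitely many zeros). *)
Definition restr {R : realType} (a : R) (n : nat) : seq bool :=
  [seq odd `|Num.floor (2 ^+ i.+1 * (a - (Num.floor a)%:~R))|%N | i <- iota 0 n].

Definition total_recursive_NQ (f : nat -> rat) : Prop :=
  exists c : rcode, forall n, (0 < n)%N ->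
    exists m, eval c [:: n] m /\ rat_decode m = f n.

Definition right_computable {R : realType} (a : R) : Prop :=
  exists f : nat -> rat, total_recursive_NQ f /\
    (forall n, (0 < n)%N -> a <= ratr (f n)) /\
    (fun n : nat => (ratr (f n) : R)) @ \oo --> (a : R).

Definition weakly_Chaitin_random {R : realType} (U : pfun) (T a : R) : Prop :=
  exists c : nat, forall n, (0 < n)%N ->
    ((T * n%:R - c%:R)%:E <= HC U (restr a n))%E.

Definition Theta {R : realType} (V : pfun) (T : R) : \bar R :=
  \esum_(s in [set s | (HC V s < ((size s)%:R : R)%:E)%E]) ((2 `^ (- (size s)%:R / T))%:E).

(* Main.v *)
(* Let u > T be the upper dyadic approximation of T at scale 2^-n. As
   Theta_V is strictly increasing, the upper bounds f(m) of Theta_V(T) and a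
   recursive enumeration of the strings s with H_V(s) < |s| let one find,
   computably from the first n bits of T, a finite set F of such strings with
   f(m) < sum_(s in F) 2^(-|s|/u). If s is not in F but H_V(s) < |s|, then
   2^(-|s|/T) <= Theta_V(T) - sum_(s in F) 2^(-|s|/T)
              < sum_(s in F) (2^(-|s|/u) - 2^(-|s|/T)) = O(2^-n)
   because T < 1, hence |s| > T(n - D) for a constant D. A string of length
   floor(T(n - D)) outside F thus satisfies H_V(s) >= |s|; it is computed from
   the first n bits of T, whose complexity is therefore at least Tn - O(1). *)
Require Import Defs.
From HB Require Import structures.
From mathcomp Require Import all_boot all_order all_algebra.
From mathcomp Require Import all_classical all_reals all_analysis.
From mathcomp Require Import zify ring lra.
Import Order.TTheory GRing.Theory Num.Theory.
Import numFieldNormedType.Exports.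
(* [eval] is otherwise shadowed by a homonym of mathcomp-analysis. *)
Import Defs.
Set Implicit Arguments.
Unset Strict Implicit.
Unset Printing Implicit Defensive.
Local Open Scope nat_scope.

(** * Recursive functions of fixed arity *)

(** The search must consist of decidable tests on integers, although the weights at exponent [u] are
    irrational in general. As [u] is a dyadic rational, comparing [j / 2^r] with such a weight
    becomes, after raising to a suitable power, an inequality between integers. Rounding downwards
    keeps accepted witnesses sound, and a large [r] recovers the strict inequality. A selection
    function for this enumerable search, applied to outputs of [U], is a machine whose domain lies
    inside that of [U] and hence is prefix-free. The constant must not depend on [n]: the two sums
    are compared through a fixed exponent [S] with [T < S < 1], and [u <= S] holds once
    [2^-n <= S - T]. Strict growth of Theta requires a compressible string, which the optimality of
    [V] supplies. *)

Definition rec (k : nat) (f : seq nat -> nat) : Prop :=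
  exists c, forall a, size a = k -> eval c a (f a).

Lemma rec_ext k f g :
  (forall a, size a = k -> f a = g a) -> rec k f -> rec k g.
Proof. by move=> fg [c cf]; exists c => a ka; rewrite -fg //; exact: cf. Qed.

Lemma rec_nth k i : rec k (fun a => nth 0 a i).
Proof. by exists (cProj i) => a _; constructor. Qed.

Lemma rec_comp k (gs : seq (seq nat -> nat)) f :
  rec (size gs) f -> (forall i, i < size gs -> rec k (nth (fun=> 0) gs i)) ->
  rec k (fun a => f [seq g a | g <- gs]).
Proof.
move=> [c cf] recgs.
suff [cs csP] : exists cs, forall a, size a = k -> evals cs a [seq g a | g <- gs].
  exists (cComp c cs) => a ka; econstructor; first exact: csP.
  by apply: cf; rewrite size_map.
elim: gs recgs {cf} => [|g gs IH] recgs; first by exists [::] => *; constructor.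
have [|cs csP] := IH; first by move=> i ilt; exact: (recgs i.+1).
have [//|d dg] := recgs 0.
by exists (d :: cs) => a ka; constructor; [exact: dg | exact: csP].
Qed.

(** Variables may be permuted, duplicated or dropped: the tool for later changes of context. *)
Lemma rec_sub k (s : seq nat) f :
  rec (size s) f -> rec k (fun a => f [seq nth 0 a i | i <- s]).
Proof.
move=> recf; have := @rec_comp k [seq (fun a => nth 0 a i) | i <- s] f.
rewrite size_map => /(_ recf) H.
apply: rec_ext (H _) => [a _|i ilt]; first by rewrite -map_comp.
by rewrite (nth_map 0) //; exact: rec_nth.
Qed.

Lemma map_nth_iota j k b : size b = j + k ->
  [seq nth 0 b i | i <- iota j k] = drop j b.
Proof.
move=> kb; rewrite -[RHS](mkseq_nth 0) size_drop kb addKn /mkseq.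
rewrite -[X in iota X](addn0 j) iotaDl -map_comp.
by apply: eq_map => i /=; rewrite nth_drop.
Qed.

Lemma rec_comp1 k f g : rec 1 (fun b => f (nth 0 b 0)) -> rec k g ->
  rec k (fun a => f (g a)).
Proof.
by move=> rf rg; apply: (@rec_comp k [:: g] (fun b => f (nth 0 b 0)) rf) => -[].
Qed.

Lemma rec_comp2 k f g h : rec 2 (fun b => f (nth 0 b 0) (nth 0 b 1)) ->
  rec k g -> rec k h -> rec k (fun a => f (g a) (h a)).
Proof.
move=> rf rg rh.
by apply: (@rec_comp k [:: g; h] (fun b => f (nth 0 b 0) (nth 0 b 1)) rf) => -[|[]].
Qed.

Lemma rec_succ k f : rec k f -> rec k (fun a => (f a).+1).
Proof.
apply: (rec_comp1 (f := succn)); exists cSucc => -[|x a] //= _.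
exact: (eSucc (x :: a)).
Qed.

Lemma rec_const k n : rec k (fun=> n).
Proof.
elim: n => [|n IH]; last exact: rec_succ.
by exists cZero => a _; constructor.
Qed.

Lemma rec_prec k N F G : rec k N -> rec k F -> rec k.+2 G ->
  rec k (fun a => nat_rec (fun=> nat) (F a) (fun n y => G (n :: y :: a)) (N a)).
Proof.
move=> recN [c cF] [d dG].
pose f b := nat_rec (fun=> nat) (F (behead b))
  (fun n y => G (n :: y :: behead b)) (head 0 b).
have recf : rec k.+1 f.
  exists (cPrec c d) => -[|x a] //= [ka]; rewrite /f /=.
  elim: x => [|x IH] /=; first by constructor; exact: cF.
  by econstructor; first exact: IH; apply: dG; rewrite /= ?ka.
have := @rec_comp k (N :: [seq (fun a => nth 0 a i) | i <- iota 0 k]) f.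
rewrite /= size_map size_iota => /(_ recf) H.
apply: rec_ext (H _) => [a ka|[|i] //= ilt].
  rewrite /f /= -map_comp (_ : map _ _ = a) //.
  by rewrite -[RHS](mkseq_nth 0 a) ka.
by rewrite (nth_map 0) ?size_iota //; exact: rec_nth.
Qed.

Lemma rec_add k f g : rec k f -> rec k g -> rec k (fun a => f a + g a).
Proof.
move=> rf rg; have := rec_prec rg rf (rec_succ (rec_nth k.+2 1)).
by apply: rec_ext => a _ /=; elim: (g a) => [|n /= ->]; rewrite ?addn0 ?addnS.
Qed.

Lemma rec_pred k f : rec k f -> rec k (fun a => (f a).-1).
Proof.
move=> rf; have := rec_prec rf (rec_const k 0) (rec_nth k.+2 0).
by apply: rec_ext => a _; case: (f a).
Qed.

Lemma rec_mul k f g : rec k f -> rec k g -> rec k (fun a => f a * g a).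
Proof.
apply: rec_comp2 => //.
have := rec_prec (rec_nth 2 1) (rec_const 2 0)
  (rec_add (rec_nth 4 1) (rec_nth 4 2)).
apply: rec_ext => -[|x [|y []]] //= _.
by elim: y => [|n /= ->]; rewrite ?muln0 // mulnS addnC.
Qed.

Lemma rec_exp k f g : rec k f -> rec k g -> rec k (fun a => f a ^ g a).
Proof.
apply: rec_comp2 => //.
have := rec_prec (rec_nth 2 1) (rec_const 2 1)
  (rec_mul (rec_nth 4 1) (rec_nth 4 2)).
by apply: rec_ext => -[|x [|y []]] //= _; elim: y => [|n /= ->] //; rewrite expnS mulnC.
Qed.

Lemma rec_subn k f g : rec k f -> rec k g -> rec k (fun a => f a - g a).
Proof.
move=> rf rg; have := rec_prec rg rf (rec_pred (rec_nth k.+2 1)).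
by apply: rec_ext => a _ /=; elim: (g a) => [|n /= ->]; rewrite ?subn0 ?subnS.
Qed.

Lemma rec_eq0 k f : rec k f -> rec k (fun a => f a == 0).
Proof.
move=> /(rec_subn (rec_const k 1)); apply: rec_ext => a _.
by case: (f a).
Qed.

Lemma rec_leq k f g : rec k f -> rec k g -> rec k (fun a => f a <= g a).
Proof. by move=> rf rg; exact: rec_eq0 (rec_subn rf rg). Qed.

Lemma rec_neg k (P : seq nat -> bool) : rec k P -> rec k (fun a => ~~ P a).
Proof. by move=> /rec_eq0; apply: rec_ext => a _; case: (P a). Qed.

Lemma rec_and k (P Q : seq nat -> bool) :
  rec k P -> rec k Q -> rec k (fun a => P a && Q a).
Proof. by move=> rP /(rec_mul rP); apply: rec_ext => a _; rewrite mulnb. Qed.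

Lemma rec_eq k f g : rec k f -> rec k g -> rec k (fun a => f a == g a).
Proof.
move=> rf rg; have := rec_and (rec_leq rf rg) (rec_leq rg rf).
by apply: rec_ext => a _; rewrite eqn_leq.
Qed.

Lemma rec_sum k N G : rec k N -> rec k.+1 G ->
  rec k (fun a => \sum_(i < N a) G (val i :: a)).
Proof.
move=> rN rG.
(* The recursion step receives [n :: y :: a] with accumulator [y]; the index list [0 :: iota 2 k]
   hides [y] from [G]. *)
have rG' : rec k.+2 (fun b => G [seq nth 0 b i | i <- 0 :: iota 2 k]).
  by apply: rec_sub; rewrite /= size_iota.
have := rec_prec rN (rec_const k 0) (rec_add (rec_nth k.+2 1) rG').
apply: rec_ext => a ka /=; elim: (N a) => [|n IH] /=; first by rewrite big_ord0.
rewrite big_ord_recr /= IH; congr (_ + G (_ :: _)).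
by rewrite map_nth_iota /= ?ka // drop0.
Qed.

Lemma rec_exists k N (P : seq nat -> bool) : rec k N -> rec k.+1 P ->
  rec k (fun a => [exists i : 'I_(N a), P (val i :: a)]).
Proof.
move=> rN rP; have := rec_neg (rec_eq0 (rec_sum rN rP)).
apply: rec_ext => a _; congr (nat_of_bool _).
rewrite sum_nat_eq0 negb_forall; apply: eq_existsb => i /=.
by case: (P _).
Qed.

Lemma rec_forall k N (P : seq nat -> bool) : rec k N -> rec k.+1 P ->
  rec k (fun a => [forall i : 'I_(N a), P (val i :: a)]).
Proof.
move=> rN rP; have := rec_neg (rec_exists rN (rec_neg rP)).
by apply: rec_ext => a _; rewrite negb_exists; under eq_forallb do rewrite negbK.
Qed.

(** * Evaluation of codes under a resource bound *)

Lemma rcode_nested_ind (P : rcode -> Prop) :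
  P cZero -> P cSucc -> (forall i, P (cProj i)) ->
  (forall f gs, P f -> List.Forall P gs -> P (cComp f gs)) ->
  (forall f g, P f -> P g -> P (cPrec f g)) ->
  (forall f, P f -> P (cMu f)) -> forall c, P c.
Proof.
move=> hZ hS hP hC hR hM; fix IH 1 => -[||i|f gs|f g|f].
- exact: hZ.
- exact: hS.
- exact: hP.
- by apply: hC; [exact: IH | elim: gs => [|g gs IHgs]; constructor].
- by apply: hR; exact: IH.
- by apply: hM; exact: IH.
Qed.

(* [F (t :: a)] is [y.+1] if [c] halts on [a] with value [y] within the
   resource bound [t], and [0] otherwise. *)
Definition clocked (k : nat) (c : rcode) (F : seq nat -> nat) : Prop :=
  [/\ rec k.+1 F,
      forall a t t' y, size a = k -> t <= t' ->
        F (t :: a) = y.+1 -> F (t' :: a) = y.+1 &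
      forall a y, size a = k -> eval c a y <-> exists t, F (t :: a) = y.+1].

Lemma clocked_total k c f : rec k f -> 
  (forall a y, size a = k -> eval c a y <-> y = f a) -> 
  exists F, clocked k c F.
Proof.
move=> rf H; exists (fun b => (f (behead b)).+1); split => //.
- apply: rec_succ; have := @rec_sub k.+1 (iota 1 k) f.
  rewrite size_iota => /(_ rf); apply: rec_ext => -[|t a] //= [ka].
  by rewrite map_nth_iota /= ?ka // drop0.
- move=> a y ka; rewrite H //=; split => [->|[_ []] //]; by exists 0.
Qed.

Lemma clocked_list k (gs : seq rcode) :
  List.Forall (fun g => exists F, clocked k g F) gs ->
  exists Fs : seq (seq nat -> nat),
  [/\ size Fs = size gs, 
      forall i, i < size Fs -> rec k.+1 (nth (fun=> 0) Fs i),
      forall a t t' ys, size a = k -> t <= t' ->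
        [seq F (t :: a) | F <- Fs] = map S ys ->
        [seq F (t' :: a) | F <- Fs] = map S ys &
      forall a ys, size a = k ->
        evals gs a ys <-> exists t, [seq F (t :: a) | F <- Fs] = map S ys].
Proof.
elim: gs => [|g gs IH] gsP.
  exists [::]; split=> // a ys ka; split.
    by move=> e; inversion e; exists 0.
  by move=> [t]; case: ys => // _; constructor.
inversion gsP as [|? ? [F [rF mF eF]] gsP']; subst.
have [Fs [sFs rFs mFs eFs]] := IH gsP'.
exists (F :: Fs); split.
- by rewrite /= sFs.
- by case=> //= i; exact: rFs.
- move=> a t t' [|y ys] //= ka tt' [Fy Fys].
  by rewrite (mF _ _ _ _ ka tt' Fy) (mFs _ _ _ _ ka tt' Fys).
- move=> a ys ka; split.
    move=> e; inversion e as [|? ? ? y ys' ey eys];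
      subst; have ka := erefl (size a).
    move: ey eys => /eF[//|t ty] /eFs[//|t' ty'].
    exists (maxn t t') => /=.
    by rewrite (mF _ _ _ _ ka (leq_maxl t t') ty) (mFs _ _ _ _ ka (leq_maxr t t') ty').
  move=> [t]; case: ys => //= y ys [Fy Fys].
  by constructor; [apply/eF => //; exists t | apply/eFs => //; exists t].
Qed.

(** All components run under one bound [t]; by monotonicity, finitely many bounds may be replaced by
    their maximum. The factor [ok] yields [0] until every component has halted. The outer code is
    clocked at every arity because it runs at arity [size gs]. *)
Lemma clocked_comp k f gs :
  (forall k, exists F, clocked k f F) ->
  List.Forall (fun g => exists F, clocked k g F) gs ->
  exists F, clocked k (cComp f gs) F.
Proof.
move=> /(_ (size gs))[F [rF mF eF]] /clocked_list[Fs [sFs rFs mFs eFs]].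
pose ok b := all (fun G => 0 < G b) Fs.
have okP b : ok b -> exists ys, [seq G b | G <- Fs] = map S ys.
  move=> /allP ob; exists [seq (G b).-1 | G <- Fs].
  rewrite -map_comp; elim: (Fs) ob => //= G l IH ob.
  by rewrite prednK ?ob ?mem_head // IH // => H Hl; apply: ob; rewrite inE Hl orbT.
have okE b ys : [seq G b | G <- Fs] = map S ys -> ok b /\ [seq (G b).-1 | G <- Fs] = ys.
  rewrite /ok; elim: (Fs) ys => [|G l IH] [|y ys] //= [-> /IH[-> ->]] //.
exists (fun b => ok b * F (head 0 b :: [seq (G b).-1 | G <- Fs])); split.
- apply: rec_mul.
    rewrite /ok; elim: (Fs) rFs => [|G l IH] rFs; first exact: (rec_const _ 1).
    apply: rec_and; first by apply: rec_leq; [exact: rec_const | exact: (rFs 0)].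
    by apply: IH => i il; exact: (rFs i.+1).
  have := @rec_comp k.+1
    ((fun b => nth 0 b 0) :: [seq (fun b => (G b).-1) | G <- Fs]) F.
  rewrite /= size_map sFs => /(_ rF) H; apply: rec_ext (H _).
    by move=> [|t a] // _; rewrite -map_comp.
  move=> [|i] /=; first by move=> _; exact: rec_nth.
  rewrite ltnS -sFs => il; rewrite (nth_map (fun=> 0)) //; apply: rec_pred; exact: rFs.
- move=> a t t' y ka tt' /=.
  case o: (ok _) => //; rewrite mul1n; have [ys ysE] := okP _ o.
  have [_ ->] := okE _ _ ysE.
  have [-> ->] := okE _ _ (mFs _ _ _ _ ka tt' ysE); rewrite mul1n.
  by apply: mF => //; rewrite -sFs -[RHS](size_map (fun G => G (t :: a))) ysE size_map.
- move=> a y ka; split.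
    move=> e; inversion e as [| | |? ? ? ys ? eys ey| | |];
      subst; have ka := erefl (size a).
    have [//|t ty] := (eFs _ _ _).1 eys.
    have sys : size ys = size gs.
      by rewrite -[LHS](size_map S) -ty size_map.
    have [//|t' ty'] := (eF _ y sys).1.
    exists (maxn t t') => /=.
    have [-> ->] := okE _ _ (mFs _ _ _ _ ka (leq_maxl t t') ty).
    by rewrite mul1n; apply: mF ty' => //; exact: leq_maxr.
  move=> [t] /=; case o: (ok _) => //; rewrite mul1n; have [ys ysE] := okP _ o.
  have [_ ->] := okE _ _ ysE => Fy.
  econstructor; first by apply/eFs => //; exists t; exact: ysE.
  apply/eF; last by exists t.
  by rewrite -sFs -[RHS](size_map (fun G => G (t :: a))) ysE size_map.
Qed.

Lemma eq_nat_rec (x x' n : nat) f f' :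
  x = x' -> (forall m y, f m y = f' m y) ->
  nat_rec (fun=> nat) x f n = nat_rec (fun=> nat) x' f' n.
Proof. by move=> -> ff'; elim: n => //= n ->. Qed.

Lemma clocked_prec k f g :
  (forall k, exists F, clocked k f F) -> (forall k, exists F, clocked k g F) ->
  exists F, clocked k (cPrec f g) F.
Proof.
case: k => [|k].
  (* No evaluation rule for [cPrec] applies to the empty list, so the clock stays at [0]. *)
  move=> _ _; exists (fun=> 0); split=> //; first exact: rec_const.
  by move=> [|//] y _; split=> [e|[]//]; inversion e.
move=> /(_ k)[F [rF mF eF]] /(_ k.+2)[G [rG mG eG]].
(* The accumulator holds the shifted value: the factor [0 < y] propagates non-termination, and
   [y.-1] is the value handed to [g]. *)
pose H t a := nat_rec (fun=> nat) (F (t :: a))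
  (fun n y => (0 < y) * G (t :: n :: y.-1 :: a)).
exists (fun b => H (nth 0 b 0) (behead (behead b)) (nth 0 b 1)); split.
- have rF' : rec k.+2 (fun b => F [seq nth 0 b i | i <- 0 :: iota 2 k]).
    by apply: rec_sub; rewrite /= size_iota.
  have := @rec_comp k.+4 [:: (fun b => nth 0 b 2), (fun b => nth 0 b 0),
    (fun b => (nth 0 b 1).-1) & [seq (fun b => nth 0 b i) | i <- iota 4 k]] G.
  rewrite /= size_map size_iota => /(_ rG) rG'.
  have {}rG' := rG' _.
  have := rec_prec (rec_nth k.+2 1) rF'
    (rec_mul (rec_leq (rec_const k.+4 1) (rec_nth k.+4 1)) (rG' _)).
  move=> Hr; apply: rec_ext (Hr _) => [[|t [|n a]] //= [ka]|].
    rewrite /H.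
    have E j l : j = size l -> [seq nth 0 (l ++ a) i | i <- iota j k] = a.
      by move=> ->; rewrite map_nth_iota ?size_cat ?ka // drop_size_cat.
    apply: eq_nat_rec => [|m y]; first by congr (F (_ :: _)); exact: (E 2 [:: t; n]).
    rewrite -map_comp.
    congr (_ * G [:: _, _, _ & _]); exact: (E 4 [:: m; y; t; n]).
  move=> [|[|[|i]]] /= il; [exact: rec_nth|exact: rec_nth| |].
    by apply: rec_pred; exact: rec_nth.
  by rewrite (nth_map 0) ?size_iota //; exact: rec_nth.
- move=> [|n a] t t' y //= [ka] tt'; elim: n y => [|n IH] y /=; first exact: mF.
  case Hn: (H t a n) => [|z] //; rewrite (IH _ Hn) /= !mul1n.
  by apply: mG => //=; rewrite ?ka.
- move=> [|n a] y //= [ka]; elim: n y => [|n IH] y /=.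
    rewrite -eF //; split => [e|]; last by constructor.
    by inversion e.
  split.
    move=> e; inversion e as [| | | | |? ? ? ? z ? en ez|];
      subst; have ka := erefl (size a).
    have [t tz] := (IH _).1 en.
    have [|t' ty] := (eG [:: n, z & a] y _).1 ez; first by rewrite /= ?ka.
    exists (maxn t t').
    have mH n' w : t <= maxn t t' -> H t a n' = w.+1 -> H (maxn t t') a n' = w.+1.
      move=> tm; elim: n' w => [|n' IH'] w /=; first exact: mF.
      case Hn: (H t a n') => [|z'] //; rewrite (IH' _ Hn) /= !mul1n.
      by apply: mG => //=; rewrite ?ka.
    rewrite (mH _ _ (leq_maxl _ _) tz) /= mul1n.
    by apply: mG ty; rewrite ?leq_maxr //= ?ka.
  move=> [t]; case Hn: (H t a n) => [|z] //=; rewrite mul1n => Gy.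
  econstructor; first by apply/IH; exists t; exact: Hn.
  by apply/eG; [rewrite /= ?ka|exists t].
Qed.

Lemma clocked_mu k f :
  (forall k, exists F, clocked k f F) -> exists F, clocked k (cMu f) F.
Proof.
move=> /(_ k.+1)[F [rF mF eF]].
(* Because of the shift, [1] encodes the value [0] and larger numbers encode positive values: by
   time [t], [y] is seen to be the least zero. At most one [y] qualifies, so the sum [G] below
   returns [y.+1] for it, or [0]. *)
pose P t a y := (F [:: t, y & a] == 1) && [forall m : 'I_y, 1 < F [:: t, val m & a]].
have Puniq t a y y' : P t a y -> P t a y' -> y = y'.
  wlog: y y' / y < y'.
    move=> W Py Py'; case: (ltngtP y y') => // yy'; first exact: W.
    by symmetry; exact: W.
  move=> yy' /andP[/eqP Fy _] /andP[_ /forallP /(_ (Ordinal yy'))].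
  by rewrite /= Fy.
pose G b := \sum_(y < nth 0 b 0) P (nth 0 b 0) (behead b) y * y.+1.
have GP t a y : (G (t :: a) = y.+1) <-> (y < t) && P t a y.
  rewrite /G /=; split => [Gy|/andP[yt Py]].
    have [/existsP[i Pi]|/existsPn N] := boolP [exists i : 'I_t, P t a i].
      move: Gy; rewrite (bigD1 i) //= Pi mul1n big1 ?addn0.
        by move=> [<-]; rewrite ltn_ord.
      move=> j ji; case Pj: (P _ _ _) => //; case/eqP: ji; apply: val_inj.
      exact: Puniq Pj Pi.
    by move: Gy; rewrite big1 // => i _; rewrite (negbTE (N i)).
  rewrite (bigD1 (Ordinal yt)) //= Py mul1n big1 ?addn0 // => j ji.
  case Pj: (P _ _ _) => //; case/eqP: ji; apply: val_inj; exact: Puniq Pj Py.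
have mP a t t' y : size a = k -> t <= t' -> P t a y -> P t' a y.
  move=> ka tt' /andP[/eqP Fy /forallP Fm]; apply/andP; split.
    by apply/eqP; apply: mF Fy => //=; rewrite ?ka.
  apply/forallP => m; have := Fm m; case E: (F _) => [|w] // w0.
  by rewrite (mF _ _ _ _ _ tt' E) //= ka.
exists G; split.
- apply: (@rec_sum k.+1 (fun b => nth 0 b 0) 
    (fun b => P (nth 0 b 1) (behead (behead b)) (nth 0 b 0) * (nth 0 b 0).+1)).
    exact: rec_nth.
  apply: rec_mul; last by apply: rec_succ; exact: rec_nth.
  apply: rec_and.
    apply: rec_eq; last exact: rec_const.
    have := @rec_sub k.+2 [:: 1, 0 & iota 2 k] F; rewrite /= size_iota => /(_ rF).
    apply: rec_ext => -[|y [|t a]] //= [ka]; congr (F [:: _, _ & _]).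
    by rewrite map_nth_iota /= ?ka // drop0.
  apply: (@rec_forall k.+2 (fun b => nth 0 b 0)
     (fun b => 1 < F [:: nth 0 b 2, nth 0 b 0 & behead (behead (behead b))])).
    exact: rec_nth.
  apply: rec_leq; first exact: rec_const.
  have := @rec_sub k.+3 [:: 2, 0 & iota 3 k] F; rewrite /= size_iota => /(_ rF).
  apply: rec_ext => -[|m [|y [|t a]]] //= [ka]; congr (F [:: _, _ & _]).
  by rewrite map_nth_iota /= ?ka // drop0.
- move=> a t t' y ka tt' /GP/andP[yt Py]; apply/GP.
  by rewrite (leq_trans yt tt') /=; exact: mP Py.
- move=> a y ka; split.
    move=> e; inversion e as [| | | | | |? ? ? ey em];
      subst; have ka := erefl (size a).
    have [|t0 t0P] := (eF (y :: a) 0 _).1 ey; first by rewrite /=.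
    have {}em m : exists t, m < y -> 1 < F [:: t, m & a].
      case: (ltnP m y) => [my|_]; last by exists 0.
      have [w ew] := em _ my.
      have [|t tP] := (eF (m :: a) w.+1 _).1 ew; first by rewrite /=.
      by exists t; rewrite tP.
    have [tm tmP] := choice em.
    pose t := maxn y.+1 (maxn t0 (\max_(m < y) tm m)).
    exists t; apply/GP; rewrite leq_maxl /=; apply/andP; split.
      apply/eqP; apply: mF t0P; rewrite //= /t; lia.
    apply/forallP => m; have := tmP m (ltn_ord m).
    case E: (F _) => [|w] // w0.
    rewrite (mF _ _ t _ _ _ E) //=.
    apply: leq_trans (leq_maxr _ _); apply: leq_trans (leq_maxr _ _).
    exact: (@leq_bigmax _ (fun m : 'I_y => tm m) m).
  move=> [t /GP/andP[yt /andP[/eqP Fy /forallP Fm]]]; constructor.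
    by apply/eF; [rewrite /= ?ka|exists t].
  move=> m my; have := Fm (Ordinal my) => /=; case E: (F _) => [|[|w]] // _.
  by exists w; apply/eF; [rewrite /= ?ka|exists t].
Qed.

(** Used in two ways: halting computations compared at a common bound give determinism, and the
    graph of a code becomes recursively enumerable. *)
Lemma clockedP c : forall k, exists F, clocked k c F.
Proof.
elim/rcode_nested_ind: c => [||i|f gs IHf IHgs|f g IHf IHg|f IHf] k.
- apply: (clocked_total (rec_const k 0)) => a y ka; split => [e|->]; last by constructor.
  by inversion e.
- apply: (clocked_total (rec_succ (rec_nth k 0))) => a y ka; rewrite nth0.
  split => [e|->]; last by constructor.
  by inversion e.
- apply: (clocked_total (rec_nth k i)) => a y ka; split => [e|->]; last by constructor.
  by inversion e.
- apply: clocked_comp => //.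
  by elim: IHgs => [|g l gP _ IH]; constructor.
- exact: clocked_prec.
- exact: clocked_mu.
Qed.

Lemma eval_fun c a y z : eval c a y -> eval c a z -> y = z.
Proof.
have [F [_ mF eF]] := clockedP c (size a).
move=> /eF[//|t ty] /eF[//|u uz]; apply: succn_inj.
by rewrite -(mF _ _ _ _ _ (leq_maxl t u) ty) // (mF _ _ _ _ _ (leq_maxr t u) uz).
Qed.

Lemma rec_drop j k f : rec k f -> rec (j + k) (fun b => f (drop j b)).
Proof.
move=> rf; have := @rec_sub (j + k) (iota j k) f.
rewrite size_iota => /(_ rf); apply: rec_ext => b kb.
by rewrite map_nth_iota.
Qed.

Lemma rec_skip j k f : rec k.+1 f ->
  rec (j.+1 + k) (fun b => f (nth 0 b 0 :: drop j.+1 b)).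
Proof.
move=> rf; have := @rec_sub (j.+1 + k) (0 :: iota j.+1 k) f.
rewrite /= size_iota => /(_ rf); apply: rec_ext => b kb.
by rewrite map_nth_iota.
Qed.

(** * Recursively enumerable relations *)

Definition re (k : nat) (P : seq nat -> Prop) : Prop :=
  exists2 Q : seq nat -> bool, rec k.+1 Q &
    forall a, size a = k -> P a <-> exists w, Q (w :: a).

Lemma re_ext k P P' : (forall a, size a = k -> P a <-> P' a) -> re k P -> re k P'.
Proof.
by move=> PP' [Q rQ PQ]; exists Q => // a ka; rewrite -PP' // PQ.
Qed.

Lemma re_dec k (P : seq nat -> bool) : rec k P -> re k P.
Proof.
move=> rP; exists (fun b => P (drop 1 b)); first exact: (rec_drop 1 rP).
by move=> a ka /=; rewrite drop0; split=> [|[]//]; exists 0.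
Qed.

(** Searching all witnesses up to [w] makes the test monotone in [w], so several witnesses merge
    into their maximum and pairing functions are avoided. *)
Lemma rec_exists_head k (Q : seq nat -> bool) : rec k.+1 Q ->
  rec k.+1 (fun b => [exists i : 'I_(nth 0 b 0).+1, Q (val i :: drop 1 b)]).
Proof.
move=> rQ.
apply: (@rec_exists k.+1 (fun b => (nth 0 b 0).+1)
  (fun b => Q (nth 0 b 0 :: drop 2 b))).
  by apply: rec_succ; exact: rec_nth.
exact: (rec_skip 1 rQ).
Qed.

Lemma re_and k P P' : re k P -> re k P' -> re k (fun a => P a /\ P' a).
Proof.
move=> [Q rQ PQ] [Q' rQ' PQ'].
exists (fun b => [exists i : 'I_(nth 0 b 0).+1, Q (val i :: drop 1 b)] &&
                 [exists i : 'I_(nth 0 b 0).+1, Q' (val i :: drop 1 b)]).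
  by apply: rec_and; exact: rec_exists_head.
move=> a ka; rewrite PQ // PQ' //= drop0; split.
  move=> [[w Qw] [w' Qw']]; exists (maxn w w'); apply/andP; split; apply/existsP.
    by exists (Ordinal (leq_maxl w w' : w < (maxn w w').+1)).
  by exists (Ordinal (leq_maxr w w' : w' < (maxn w w').+1)).
by move=> [w /andP[/existsP[i Qi] /existsP[j Qj]]]; split; [exists i|exists j].
Qed.

Lemma re_ex k P : re k.+1 P -> re k (fun a => exists x, P (x :: a)).
Proof.
move=> [Q rQ PQ].
exists (fun b => [exists x : 'I_(nth 0 b 0).+1, exists i : 'I_(nth 0 b 0).+1,
                 Q [:: val i, val x & drop 1 b]]).
  apply: (@rec_exists k.+1 (fun b => (nth 0 b 0).+1) (fun b => 
     [exists i : 'I_(nth 0 b 1).+1, Q [:: val i, nth 0 b 0 & drop 2 b]])).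
    by apply: rec_succ; exact: rec_nth.
  apply: (@rec_exists k.+2 (fun b => (nth 0 b 1).+1)
     (fun b => Q [:: nth 0 b 0, nth 0 b 1 & drop 3 b])).
    by apply: rec_succ; exact: rec_nth.
  have := @rec_sub (3 + k) [:: 0, 1 & iota 3 k] Q.
  rewrite /= size_iota => /(_ rQ); apply: rec_ext => b kb.
  by rewrite map_nth_iota.
move=> a ka; rewrite /= drop0; split.
  move=> [x]; rewrite PQ /= ?ka // => -[w Qw]; exists (maxn w x).
  apply/existsP; exists (Ordinal (leq_maxr w x : x < (maxn w x).+1)).
  by apply/existsP; exists (Ordinal (leq_maxl w x : w < (maxn w x).+1)).
move=> [w /existsP[x /existsP[i Qi]]]; exists x; rewrite PQ /= ?ka //.
by exists i.
Qed.

Lemma re_eval c k f g : rec k f -> rec k g ->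
  re k (fun a => eval c [:: f a] (g a)).
Proof.
move=> rf rg; have [F [rF _ eF]] := clockedP c 1.
exists (fun b => F [:: nth 0 b 0; f (drop 1 b)] == (g (drop 1 b)).+1).
  apply: rec_eq; last by apply: rec_succ; exact: (rec_drop 1 rg).
  apply: (@rec_comp k.+1 [:: (fun b => nth 0 b 0); (fun b => f (drop 1 b))]) => //.
  by move=> [|[|]] //= _; [exact: rec_nth | exact: (rec_drop 1 rf)].
move=> a ka; rewrite eF //= drop0.
by split=> -[t] /eqP; exists t => //; exact/eqP.
Qed.

Lemma rec_mu k f : rec k.+1 f -> exists c, forall a n, size a = k ->
  eval c a n <-> f (n :: a) = 0 /\ forall m, m < n -> f (m :: a) <> 0.
Proof.
move=> [c cf]; exists (cMu c) => a n ka.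
have cfa m : eval c (m :: a) (f (m :: a)) by apply: cf; rewrite /= ka.
split.
  move=> e; inversion e as [| | | | | |? ? ? en em]; subst.
  split; first exact: eval_fun en.
  by move=> m /em[y my]; rewrite (eval_fun (cfa m) my).
move=> [fn fm]; constructor; first by rewrite -fn.
move=> m /fm; case E: (f _) => [|y] // _; exists y.
by rewrite -E.
Qed.

Lemma least_nat (P : nat -> bool) n : P n ->
  exists2 m, P m & forall i, i < m -> ~~ P i.
Proof.
move=> Pn; exists (ex_minn (ex_intro _ n Pn)); case: ex_minnP => // m Pm min i.
by apply: contraL => /min; rewrite leqNgt.
Qed.

(** Two minimizations replace a search over pairs: [cf] finds the least [v] bounding some output and
    its witness, then [cg] the least output with a witness at most [v]. Both tests are negated since
    [cMu] looks for zeros. *)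
Lemma re_uniformize A : re 2 A -> exists c,
  (forall x y, eval c [:: x] y -> A [:: y; x]) /\
  (forall x y, A [:: y; x] -> exists y', eval c [:: x] y').
Proof.
move=> [Q rQ AQ].
pose f b := ~~ [exists y : 'I_(nth 0 b 0).+1, exists w : 'I_(nth 0 b 0).+1,
                Q [:: val w; val y; nth 0 b 1]].
pose g b := ~~ [exists w : 'I_(nth 0 b 1).+1, Q [:: val w; nth 0 b 0; nth 0 b 2]].
have rQ' k i j l : rec k (fun b => Q [:: nth 0 b i; nth 0 b j; nth 0 b l]).
  exact: (@rec_sub k [:: i; j; l] Q rQ).
have [cf cfP] : exists c, forall x v, eval c [:: x] v <->
    f [:: v; x] = 0 :> nat /\ forall m, m < v -> f [:: m; x] <> 0 :> nat.
  have [|c cP] := @rec_mu 1 f; last by exists c => x v; exact: cP.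
  apply: rec_neg.
  apply: (@rec_exists 2 (fun b => (nth 0 b 0).+1) (fun b => 
     [exists i : 'I_(nth 0 b 1).+1, Q [:: val i; nth 0 b 0; nth 0 b 2]])).
    by apply: rec_succ; exact: rec_nth.
  apply: (@rec_exists 3 (fun b => (nth 0 b 1).+1)
    (fun b => Q [:: nth 0 b 0; nth 0 b 1; nth 0 b 3])) => //.
  by apply: rec_succ; exact: rec_nth.
have [cg cgP] : exists c, forall v x y, eval c [:: v; x] y <->
    g [:: y; v; x] = 0 :> nat /\ forall m, m < y -> g [:: m; v; x] <> 0 :> nat.
  have [|c cP] := @rec_mu 2 g; last by exists c => v x y; exact: cP.
  apply: rec_neg.
  apply: (@rec_exists 3 (fun b => (nth 0 b 1).+1)
    (fun b => Q [:: nth 0 b 0; nth 0 b 1; nth 0 b 3])) => //.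
  by apply: rec_succ; exact: rec_nth.
exists (cComp cg [:: cf; cProj 0]); split=> [x y e|x y].
  inversion e as [| | |? ? ? ys ? eys ey| | |]; subst.
  inversion eys as [|? ? ? v ? ev eys']; subst.
  inversion eys' as [|? ? ? x' ? ex eys'']; subst.
  inversion eys''; subst; inversion ex; subst.
  have [+ _] := (cgP _ _ _).1 ey; rewrite /g /=.
  case: existsP => //= -[w Qw] _; apply/AQ => //; by exists w.
move=> /AQ[//|w Qw].
pose h v := [exists y : 'I_v.+1, exists w : 'I_v.+1, Q [:: val w; val y; x]].
have hv : h (maxn w y).
  apply/existsP; exists (Ordinal (leq_maxr w y : y < (maxn w y).+1)).
  by apply/existsP; exists (Ordinal (leq_maxl w y : w < (maxn w y).+1)).
have [v hv' vmin] := least_nat hv.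
have ev : eval cf [:: x] v.
  apply/cfP; rewrite /f /=; split; first by rewrite -/(h v) hv'.
  by move=> m /vmin; rewrite -/(h m) => ->.
have /existsP[z hz] := hv'.
have [u hu umin] := @least_nat (fun y => [exists w : 'I_v.+1, Q [:: val w; y; x]]) _ hz.
exists u; econstructor.
  by econstructor; [exact: ev | econstructor; constructor].
apply/cgP; rewrite /g /=; split; first by rewrite hu.
by move=> m /umin ->.
Qed.

Lemma re_stages A : re 1 A -> exists Sd : nat -> nat -> bool,
  [/\ rec 2 (fun a => Sd (nth 0 a 0) (nth 0 a 1)),
      forall k k' i, k <= k' -> Sd k i -> Sd k' i &
      forall i, A [:: i] <-> exists k, Sd k i].
Proof.
move=> [Q rQ AQ]; exists (fun k i => [exists w : 'I_k, Q [:: val w; i]]); split.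
- apply: (@rec_exists 2 (fun b => nth 0 b 0) (fun b => Q [:: nth 0 b 0; nth 0 b 2])).
    exact: rec_nth.
  exact: (@rec_sub 3 [:: 0; 2] Q rQ).
- move=> k k' i kk' /existsP[w Qw]; apply/existsP.
  by exists (widen_ord kk' w).
- move=> i; rewrite AQ //; split=> [[w Qw]|[k /existsP[w Qw]]]; last by exists w.
  by exists w.+1; apply/existsP; exists ord_max.
Qed.

(** * Codes of strings and prefix-free machines *)

(** This is [str_code] before the predecessor is taken; strings of length [l] fill the interval from
    [2^l] to [2^(l+1) - 1]. *)
Definition bin_val (s : seq bool) : nat := foldl (fun n (b : bool) => n.*2 + b) 1 s.

Lemma bin_val_rcons s b : bin_val (rcons s b) = (bin_val s).*2 + b.
Proof. by rewrite /bin_val foldl_rcons. Qed.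

Lemma bin_val_bounds s : 2 ^ size s <= bin_val s < 2 ^ (size s).+1.
Proof.
elim/last_ind: s => [//|s b]; rewrite bin_val_rcons size_rcons !expnS.
by case: b; lia.
Qed.

Lemma bin_val_gt0 s : 0 < bin_val s.
Proof. by have /andP[+ _] := bin_val_bounds s; apply: leq_trans; rewrite expn_gt0. Qed.

Lemma str_codeS s : (str_code s).+1 = bin_val s.
Proof. by rewrite /str_code prednK // bin_val_gt0. Qed.

Lemma bin_val_inj : injective bin_val.
Proof.
elim/last_ind=> [|s b IH] t; case/lastP: t => [|t c] //; rewrite ?bin_val_rcons.
- by have := bin_val_gt0 t; rewrite /(bin_val [::]) /=; lia.
- by have := bin_val_gt0 s; rewrite /(bin_val [::]) /=; lia.
- move=> E; have bc : b = c by move: E; case: b; case: c; lia.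
  by rewrite bc (IH t) //; move: E; rewrite bc; lia.
Qed.

Lemma str_code_inj : injective str_code.
Proof. by move=> s t E; apply: bin_val_inj; rewrite -!str_codeS E. Qed.

Lemma str_code_surj n : exists s, str_code s = n.
Proof.
suff [s sn] : exists s, bin_val s = n.+1.
  by exists s; apply: succn_inj; rewrite str_codeS.
elim/ltn_ind: n => -[|n] IH; first by exists [::].
have [|s sn] := IH n./2; first lia.
exists (rcons s (odd n.+2)); rewrite bin_val_rcons sn; lia.
Qed.

(* The length of the string with code [i]. *)
Definition nlen (i : nat) : nat := \sum_(l < i.+1) (2 ^ l.+1 <= i.+1).

Lemma sum_ltn_ord N M : \sum_(j < M) (j < N) = minn N M.
Proof.
elim: M => [|M IH]; first by rewrite big_ord0 minn0.
by rewrite big_ord_recr /= IH; case: ltnP; lia.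
Qed.

Lemma nlen_code s : nlen (str_code s) = size s.
Proof.
rewrite /nlen; transitivity (\sum_(l < (str_code s).+1) (l < size s)).
  apply: eq_bigr => -[l /= _] _; congr (nat_of_bool _); rewrite str_codeS.
  have /andP[lo hi] := bin_val_bounds s; apply/idP/idP => [E|E].
    by rewrite -ltnS -(ltn_exp2l _ _ (isT : 1 < 2)) (leq_ltn_trans E hi).
  by apply: leq_trans lo; rewrite leq_exp2l.
rewrite sum_ltn_ord; apply/minn_idPl; rewrite str_codeS.
have /andP[+ _] := bin_val_bounds s; apply: leq_trans.
by rewrite ltnW // ltn_expl.
Qed.

Lemma rec_nlen k f : rec k f -> rec k (fun a => nlen (f a)).
Proof.
apply: rec_comp1.
apply: (@rec_sum 1 (fun b => (nth 0 b 0).+1)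
  (fun b => 2 ^ (nth 0 b 0).+1 <= (nth 0 b 1).+1)).
  by apply: rec_succ; exact: rec_nth.
apply: rec_leq; last by apply: rec_succ; exact: rec_nth.
by apply: rec_exp; [exact: rec_const | apply: rec_succ; exact: rec_nth].
Qed.

(** Which related output the machine selects is left open, hence the two one-sided conclusions. *)
Lemma re_machine A : re 2 A -> exists C : pfun, [/\ partial_recursive C,
  forall p y, C p = Some y -> A [:: str_code y; str_code p] &
  forall p y, A [:: y; str_code p] -> C p <> None].
Proof.
move=> /re_uniformize[c [cA Ac]].
pose C p := if pselect (exists y, eval c [:: str_code p] (str_code y)) is left e
            then Some (sval (cid e)) else None.
have CP p y : C p = Some y <-> eval c [:: str_code p] (str_code y).
  rewrite /C; case: pselect => [e|n]; split=> //; last by move=> e; case: n; exists y.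
    by case: (cid e) => z ez /= [<-].
  by case: (cid e) => z ez /= ey; congr Some; apply/str_code_inj/(eval_fun ez).
exists C; split=> [|p y /CP/cA//|p y /Ac[y' ey']]; first by exists c.
have [s sy'] := str_code_surj y'.
by rewrite -sy' in ey'; move/CP: ey' => ->.
Qed.

(** A machine that nearly halves lengths beats the additive constant of [V] on long outputs. *)
Lemma optimal_compresses V : optimal V -> exists s p, V p = Some s /\ size p < size s.
Proof.
move=> [_ Vopt].
(* [A] relates the code of [1^j 0] to that of [0^(2 j)]. *)
pose A a := exists j, (nth 0 a 1 + 3 == 2 ^ (j + 2)) && ((nth 0 a 0).+1 == 2 ^ (2 * j)).
have /re_machine[C [recC CA AC]] : re 2 A.
  apply: (@re_ex 2 (fun a => (nth 0 a 2 + 3 == 2 ^ (nth 0 a 0 + 2)) &&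
    ((nth 0 a 1).+1 == 2 ^ (2 * nth 0 a 0)))).
  apply: re_dec; apply: rec_and; apply: rec_eq.
  - apply: rec_add; [exact: rec_nth | exact: rec_const].
  - apply: rec_exp; first exact: rec_const.
    apply: rec_add; [exact: rec_nth | exact: rec_const].
  - apply: rec_succ; exact: rec_nth.
  - apply: rec_exp; first exact: rec_const.
    apply: rec_mul; [exact: rec_const | exact: rec_nth].
pose q j := rcons (nseq j true) false.
have qv j : bin_val (q j) + 2 = 2 ^ (j + 2).
  suff : bin_val (nseq j true) + 1 = 2 ^ j.+1.
    by rewrite bin_val_rcons (addn2 j) (expnS 2 j.+1); lia.
  elim: j => // j IH.
  have -> : nseq j.+1 true = rcons (nseq j true) true.
    by rewrite -cats1 -(nseqD j 1) addn1.
  rewrite bin_val_rcons (expnS 2 j.+1); lia.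
have qP p j : str_code p + 3 = 2 ^ (j + 2) -> p = q j.
  by move=> E; apply: bin_val_inj; have := qv j; rewrite -E -(str_codeS p); lia.
have [|d dP] := Vopt C.
  split=> // p p'; rewrite /dom /=.
  case Cp : (C p) => [y|] // _; case Cp' : (C p') => [y'|] // _.
  have [j /andP[/eqP/qP pj _]] := CA _ _ Cp.
  have [j' /andP[/eqP/qP pj' _]] := CA _ _ Cp'.
  rewrite pj pj' /q => /prefixP[r E].
  have := congr1 size E; rewrite size_cat !size_rcons !size_nseq => sE.
  case: (ltngtP j j') => [jj'|jj'|->//]; last lia.
  have := congr1 (fun s => nth true s j) E.
  rewrite nth_cat size_rcons size_nseq ltnSn !nth_rcons !size_nseq ltnn eqxx jj'.
  by rewrite nth_nseq jj'.
(* The [V]-program has length at most [j + 1 + d = 2 d + 3], less than the output length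
   [2 j = 2 d + 4]. *)
pose j := d + 2.
have Cq : dom C (q j).
  apply: (AC _ (2 ^ (2 * j)).-1); exists j => /=.
  rewrite prednK ?expn_gt0 // eqxx andbT -(qv j) -str_codeS; apply/eqP; lia.
have [p [_ [pE sp]]] := dP _ Cq.
move: pE Cq; rewrite /dom /=; case Cq: (C _) => [s|] // pE _.
exists s, p; split=> //; apply: (leq_ltn_trans sp).
have [j' /andP[/eqP E /eqP sE]] := CA _ _ Cq.
have jj' : j' = j.
  by move: (qP _ _ E) => /(congr1 size); rewrite !size_rcons !size_nseq => -[].
have : 2 ^ (2 * j) < 2 ^ (size s).+1.
  by rewrite -jj' -sE str_codeS; have /andP[] := bin_val_bounds s.
by rewrite ltn_exp2l // size_rcons size_nseq /j; lia.
Qed.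

(** * The series Theta *)

Local Open Scope ring_scope.

Definition compr (V : pfun) (i : nat) : Prop :=
  exists s p, [/\ str_code s = i, V p = Some s & (size p < size s)%N].

Lemma HC_ltP (R : realType) (V : pfun) (s : seq bool) :
  (HC V s < ((size s)%:R : R)%:E)%E <-> compr V (str_code s).
Proof.
split.
  move=> /ereal_inf_lt[_ [p /= Vp <-]]; rewrite lte_fin ltr_nat => ps.
  by exists s, p.
move=> [t [p [/str_code_inj-> Vp ps]]].
apply: (@le_lt_trans _ _ ((size p)%:R)%:E); last by rewrite lte_fin ltr_nat.
by apply: ereal_inf_lbound; exists p.
Qed.

Definition wt {R : realType} (t : R) (i : nat) : R := 2 `^ (- (nlen i)%:R / t).

Lemma wt_gt0 (R : realType) (t : R) i : 0 < wt t i.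
Proof. by rewrite powR_gt0. Qed.

Lemma Theta_ge (R : realType) V (T : R) (l : seq nat) :
  Theta V T \is a fin_num -> uniq l -> (forall i, i \in l -> compr V i) ->
  \sum_(i <- l) wt T i <= fine (Theta V T).
Proof.
move=> Tfin ul lV; rewrite -lee_fin fineK //.
have [d dK] := choice str_code_surj.
apply: esum_ge; exists ([set` [seq d i | i <- l]])%classic.
  split; first exact: finite_seq.
  move=> s /= /mapP[i il ->]; apply/HC_ltP; rewrite dK; exact: lV.
rewrite -fsbig_seq ?map_inj_uniq //; last exact: can_inj dK.
rewrite big_map sumEFin lee_fin; apply: ler_sum => i _.
by rewrite /wt -nlen_code dK.
Qed.

Lemma Theta_gt (R : realType) V (T e : R) :
  Theta V T \is a fin_num -> e < fine (Theta V T) ->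
  exists l : seq nat, [/\ uniq l, forall i, i \in l -> compr V i &
    e < \sum_(i <- l) wt T i].
Proof.
move=> Tfin; rewrite -lte_fin fineK // => /ereal_sup_gt[_ [X [finX XS] <-]] eX.
have [l0 Xl0] := (finite_seqP X).1 finX; pose l := undup l0.
have Xl : X = [set` l]%classic.
  by rewrite Xl0; apply/seteqP; split=> s /=; rewrite mem_undup.
exists [seq str_code s | s <- l]; split.
- by rewrite map_inj_uniq ?undup_uniq //; exact: str_code_inj.
- by move=> _ /mapP[s sX ->]; apply/(@HC_ltP R); apply: XS; rewrite Xl.
- move: eX; rewrite Xl -fsbig_seq ?undup_uniq // sumEFin lte_fin => /lt_le_trans; apply.
  by rewrite big_map; apply: ler_sum => s _; rewrite /wt nlen_code.
Qed.

(** The strings of length [m] have exactly the codes from [2^m - 1] to [2^(m+1) - 2]. *)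
Lemma sum_nlen (R : realType) (g : nat -> R) M :
  \sum_(0 <= i < 2 ^ M - 1) g (nlen i) = \sum_(m < M) 2 ^+ m * g m.
Proof.
elim: M => [|M IH]; first by rewrite big_geq // big_ord0.
rewrite big_ord_recr /= -IH (@big_cat_nat _ _ _ (2 ^ M - 1)) ?leq_sub2r ?leq_exp2l //=.
congr (_ + _); rewrite (@eq_big_nat _ _ _ _ _ _ (fun=> g M)).
  rewrite sumr_const_nat -[LHS]mulr_natl; congr (_ * _).
  rewrite -natrX; congr (_%:R); rewrite expnS; have := expn_gt0 2 M; lia.
move=> i /andP[lo hi]; congr g.
have [s si] := str_code_surj i; rewrite -si nlen_code.
have := bin_val_bounds s; rewrite -str_codeS si => /andP[h1 h2].
have M0 := expn_gt0 2 M.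
have : (2 ^ size s < 2 ^ M.+1)%N by apply: (leq_ltn_trans h1); lia.
have : (2 ^ M < 2 ^ (size s).+1)%N by apply: leq_ltn_trans h2; lia.
by rewrite !ltn_exp2l //; lia.
Qed.

Lemma sum_geometric_deriv (R : realType) (q : R) N : 0 < q < 1 ->
  \sum_(m < N) m%:R * q ^+ m <= q / (1 - q) ^+ 2.
Proof.
move=> /andP[q0 q1].
(* The finite form of the differentiated geometric series; the subtracted term is nonnegative. *)
have E : (\sum_(m < N) m%:R * q ^+ m) * (1 - q) ^+ 2 =
   q - (N%:R * (1 - q) + q) * q ^+ N.
  elim: N => [|N IH]; first by rewrite big_ord0 expr0; ring.
  by rewrite big_ord_recr /= mulrDl IH (exprS q N) -(natr1 N); ring.
rewrite ler_pdivlMr ?exprn_gt0 ?subr_gt0 // E gerBl.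
by rewrite mulr_ge0 ?exprn_ge0 ?addr_ge0 ?mulr_ge0 ?subr_ge0 ?ler0n // ltW.
Qed.

(** Put [d = 1/T - 1/u] and [l = nlen i]. Then [wt T i] is [wt u i] times [2^(-l d)], and
    [2^(-l d) >= 1 - l d] because [ln 2 <= 1]. Finally [d <= (u - T) / T^2] and
    [wt u i <= wt T1 i]. *)
Lemma wt_diff (R : realType) (T u T1 : R) i : 0 < T -> T <= u -> u <= T1 ->
  wt u i - wt T i <= (u - T) * (T ^- 2 * ((nlen i)%:R * wt T1 i)).
Proof.
move=> T0 Tu uT1; have u0 : 0 < u by exact: lt_le_trans Tu.
have T10 : 0 < T1 by exact: lt_le_trans uT1.
set l := (nlen i)%:R; have l0 : 0 <= l by rewrite ler0n.
have ln2 : 0 <= ln (2 : R) <= 1.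
  rewrite ln_ge0 ?ler1n //=; have : ln (1 + 1 : R) <= 1 by apply: le_ln1Dx; lra.
  by [].
have d0 : 0 <= T^-1 - u^-1 by rewrite subr_ge0 lef_pV2.
have wT : wt u i * (1 - l * (T^-1 - u^-1)) <= wt T i.
  have -> : wt T i = wt u i * 2 `^ (- (l * (T^-1 - u^-1))).
    rewrite /wt -powRD; last by rewrite (_ : (2 == 0 :> R) = false) ?implybT // pnatr_eq0.
    by congr (_ `^ _); rewrite -/l; ring.
  rewrite ler_pM2l ?wt_gt0 // /powR pnatr_eq0 /=.
  apply: le_trans (expR_ge1Dx _); rewrite mulNr lerD2l lerN2.
  by rewrite ler_piMr ?mulr_ge0 //; case/andP: ln2.
have d1 : T^-1 - u^-1 <= (u - T) * T ^- 2.
  have -> : T^-1 - u^-1 = (u - T) * (T^-1 * u^-1) by field; rewrite !gt_eqF.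
  rewrite ler_wpM2l ?subr_ge0 // expr2 invfM ler_wpM2l ?invr_ge0 ?(ltW T0) //.
  by rewrite -subr_ge0.
have w1 : wt u i <= wt T1 i.
  apply: ler_powR; first by rewrite ler1n.
  by rewrite !mulNr lerN2 ler_wpM2l // lef_pV2.
apply: (@le_trans _ _ (wt u i * (l * (T^-1 - u^-1)))); first lra.
rewrite [leRHS](_ : _ = wt T1 i * (l * ((u - T) * T ^- 2))); last by rewrite -/l; ring.
apply: ler_pM => //; first by rewrite ltW ?wt_gt0.
  by rewrite mulr_ge0.
by rewrite ler_wpM2l.
Qed.

Lemma wt_expr (R : realType) (t : R) i : wt t i = (2 `^ (- t^-1)) ^+ nlen i.
Proof.
by rewrite -powR_mulrn ?powR_ge0 // -powRrM /wt; congr (_ `^ _); ring.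
Qed.

(** Grouped by length, the bounds of [wt_diff] form a series of terms [m q^m] with [q = 2 rho], and
    [q < 1] because [T1 < 1]. The constant is uniform in [k] and [P], since the enumerated set
    varies with the search. *)
Lemma wt_diff_sum (R : realType) (T T1 : R) : 0 < T -> T < T1 -> T1 < 1 ->
  exists B : R, forall u k (P : pred nat), T <= u -> u <= T1 ->
  \sum_(i < k | P i) (wt u i - wt T i) <= B * (u - T).
Proof.
move=> T0 TT1 T11; have T10 : 0 < T1 by exact: lt_trans TT1.
pose rho : R := 2 `^ (- T1^-1).
have rho0 : 0 < rho by rewrite powR_gt0.
have q01 : 0 < 2 * rho < 1.
  rewrite mulr_gt0 //= /rho powRN ltr_pdivrMr ?powR_gt0 // mul1r.
  rewrite -[ltLHS]powRr1 // /powR pnatr_eq0 /= ltr_expR ltr_pM2r ?ln_gt0 ?ltr1n //.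
  by rewrite invf_gt1.
pose B := T ^- 2 * (2 * rho / (1 - 2 * rho) ^+ 2).
have Tm2 : 0 <= T ^- 2 by rewrite invr_ge0 exprn_ge0 // ltW.
exists B => u k P Tu uT1.
apply: (@le_trans _ _ (\sum_(i < k | P i)
    (u - T) * (T ^- 2 * ((nlen i)%:R * wt T1 i)))).
  by apply: ler_sum => i _; exact: wt_diff.
rewrite -!mulr_sumr mulrC ler_wpM2r ?subr_ge0 // /B ler_wpM2l //.
pose g m := m%:R * rho ^+ m.
have g0 m : 0 <= g m by rewrite mulr_ge0 ?ler0n // exprn_ge0 // ltW.
(* The range is enlarged to all strings of length below [k], where grouping by length applies. *)
apply: (@le_trans _ _ (\sum_(0 <= i < 2 ^ k - 1) g (nlen i))).
  apply: (@le_trans _ _ (\sum_(i < k) g (nlen i))).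
    rewrite [leLHS]big_mkcond; apply: ler_sum => i _; case: ifP => // _.
    by rewrite wt_expr.
  rewrite -(big_mkord xpredT (fun i => g (nlen i))).
  have kk : (k <= 2 ^ k - 1)%N by rewrite leq_subRL ?expn_gt0 // ltn_expl.
  by rewrite (@big_cat_nat _ _ _ k 0 (2 ^ k - 1)) //= lerDl sumr_ge0.
rewrite sum_nlen; apply: le_trans (sum_geometric_deriv k q01).
by apply: ler_sum => m _; rewrite /g exprMn; lra.
Qed.

(* The sum counts the [j >= 1] with [(j / 2 ^ r) ^ (v + 1) <= 2 ^ (- l * 2 ^ n)],
   that is, [j / 2 ^ r <= 2 ^ (- l / u)] for [u = (v + 1) / 2 ^ n]. *)
Definition approx_count (n v r l : nat) : nat :=
  (\sum_(j < 2 ^ r) (j.+1 ^ v.+1 * 2 ^ (l * 2 ^ n) <= 2 ^ (r * v.+1)))%N.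

Lemma approx_countE (R : realType) n v r i :
  approx_count n v r (nlen i) =
  Num.truncn (2 ^+ r * wt (v.+1%:R / 2 ^+ n : R) i).
Proof.
set u := (_ / _); set X := wt u i; set Y := _ * X.
have u0 : 0 < u by rewrite divr_gt0 ?ltr0n ?exprn_gt0.
have X0 : 0 < X by exact: wt_gt0.
have Y0 : 0 < Y by rewrite mulr_gt0 ?exprn_gt0.
have X1 : X <= 1.
  rewrite /X /wt -[leRHS](powRr0 2); apply: ler_powR; first by rewrite ler1n.
  by rewrite mulNr oppr_le0 divr_ge0 ?ler0n // ltW.
(* Since [(v + 1) / u = 2^n], the power [v + 1] makes the exponent an integer; the test in
   [approx_count] is the inequality [j + 1 <= Y] raised to that power. *)
have Xv : X ^+ v.+1 * 2 ^+ (nlen i * 2 ^ n) = 1.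
  rewrite /X /wt -powR_mulrn ?powR_ge0 // -powRrM.
  rewrite (_ : - _ / u * _ = - (nlen i * 2 ^ n)%:R).
    by rewrite powRN powR_mulrn // mulVf // expf_eq0 pnatr_eq0 andbF.
  rewrite /u natrM natrX; field.
  by rewrite expf_neq0 ?pnatr_eq0 //= addrC natr1 pnatr_eq0.
transitivity (\sum_(j < 2 ^ r) (j < Num.truncn Y))%N.
  apply: eq_bigr => j _; congr (nat_of_bool _).
  rewrite truncn_gt_nat -(ler_nat R) natrM !natrX (exprM _ r).
  rewrite -(@ler_pXn2r _ v.+1 _ j.+1%:R Y) ?nnegrE ?ler0n ?(ltW Y0) //.
  have p0 : (0 : R) < 2 ^+ (nlen i * 2 ^ n) by rewrite exprn_gt0.
  rewrite /Y exprMn -[RHS](ler_pM2r p0).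
  by rewrite -[X in _ = (_ <= X)]mulrA Xv mulr1.
rewrite sum_ltn_ord; apply/minn_idPl; rewrite -(ler_nat R) natrX.
apply: (@le_trans _ _ Y); first by rewrite truncn_le ltW.
by rewrite /Y ler_piMr // exprn_ge0.
Qed.

Lemma rat_decodeE e z b : (e.+1 = 2 ^ (2 * z) * (2 * b).+1)%N ->
  rat_decode e = z%:R / b.+1%:R.
Proof.
move=> E; have Ea : logn 2 e.+1 = (2 * z)%N.
  rewrite E lognM ?expn_gt0 // pfactorK // (_ : logn 2 _ = 0)%N ?addn0 //.
  by rewrite logn_coprime // coprime2n /= oddM.
rewrite /rat_decode Ea E mulKn ?expn_gt0 // /zig oddM [odd 2]/= andFb.
have -> : (2 * b).+1./2 = b by lia.
by have -> : (2 * z)./2 = z by lia.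
Qed.

(** Odd exponents of two decode to negative numbers. Upper bounds of Theta are nonnegative, so
    [search] may confine itself to even exponents [2 * z]. *)
Lemma rat_decode_ge0 e : 0 <= rat_decode e ->
  exists z b, (e.+1 = 2 ^ (2 * z) * (2 * b).+1)%N.
Proof.
have [c oc E] : exists2 c, odd c & (e.+1 = 2 ^ logn 2 e.+1 * c)%N.
  have [//|c] := @pfactor_coprime 2 e.+1 isT; rewrite coprime2n mulnC => oc E.
  by exists c.
rewrite /rat_decode; set a := logn 2 e.+1 in E *; set b := (_./2).
rewrite /zig; case oa : (odd a).
  rewrite pmulr_lge0 ?invr_gt0 ?ltr0n // mulrNz oppr_ge0 -[0]/(0%:~R) ler_int.
  by case: (a) oa => [|a'].
move=> _; exists a./2, c./2; rewrite {1}E; congr (2 ^ _ * _)%N; lia.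
Qed.

(** Pigeonhole: [2^L] strings of length [L] would need distinct programs among the [2^L - 1] shorter
    strings. *)
Lemma exists_incompressible V L : exists y, nlen y = L /\ ~ compr V y.
Proof.
apply/not_existsP => H.
have F (i : 'I_(2 ^ L)) : exists j : 'I_(2 ^ L - 1), exists s p,
    [/\ str_code s = (2 ^ L - 1 + i)%N, V p = Some s & str_code p = j].
  have [s si] := str_code_surj (2 ^ L - 1 + i).
  have M0 := expn_gt0 2 L; have iL := ltn_ord i.
  have sL : size s = L.
    have := bin_val_bounds s; rewrite -str_codeS si => /andP[h1 h2].
    have : (2 ^ size s < 2 ^ L.+1)%N by apply: (leq_ltn_trans h1); rewrite expnS; lia.
    have : (2 ^ L < 2 ^ (size s).+1)%N by apply: leq_ltn_trans h2; lia.
    by rewrite !ltn_exp2l //; lia.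
  have [s' [p [/str_code_inj-> Vp ps]]] : compr V (str_code s).
    apply: contrapT => nc; apply: (H (str_code s)); split=> //.
    by rewrite nlen_code.
  have pj : (str_code p < 2 ^ L - 1)%N.
    have /andP[_] := bin_val_bounds p; rewrite -str_codeS.
    have : (2 ^ (size p).+1 <= 2 ^ L)%N by rewrite leq_exp2l // -sL.
    lia.
  by exists (Ordinal pj), s, p.
have [f fP] := choice F.
suff /leq_card : injective f by rewrite !card_ord; have := expn_gt0 2 L; lia.
move=> i j fij; apply: val_inj.
have [s [p [si Vp pi]]] := fP i; have [t [q [tj Vq qj]]] := fP j.
have pq : p = q by apply: str_code_inj; rewrite pi qj fij.
by move: Vq; rewrite -pq Vp => -[st]; move: si; rewrite st tj => /addnI.
Qed.

(** * The search for an incompressible string *)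

(* The input [x] is the code of the first [n] bits of [T]. The witnesses are:
   [e], the code of the rational [f m = z / (b + 1)]; [k], the stage up to which
   compressible strings are enumerated; [r], the precision of the dyadic
   approximations; [y], the code of the output. *)
Definition search (Sd : nat -> nat -> bool) (D x y e m k r z b : nat) : bool :=
  [&& 0 < m, e.+1 == 2 ^ (2 * z) * (2 * b).+1,
      z * 2 ^ r < b.+1 * \sum_(i < k)
         Sd k i * approx_count (nlen x) (x.+1 - 2 ^ nlen x) r (nlen i),
      ~~ ((y < k) && Sd k y),
      nlen y * 2 ^ nlen x <= (x.+1 - 2 ^ nlen x) * (nlen x - D) &
      (x.+1 - 2 ^ nlen x) * (nlen x - D) < (nlen y).+1 * 2 ^ nlen x]%N.

Lemma rec_approx_count k f g h l : rec k f -> rec k g -> rec k h -> rec k l ->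
  rec k (fun a => approx_count (f a) (g a) (h a) (l a)).
Proof.
move=> rf rg rh rl.
suff R4 : rec 4 (fun a =>
    approx_count (nth 0 a 0) (nth 0 a 1) (nth 0 a 2) (nth 0 a 3))%N.
  by apply: (@rec_comp k [:: f; g; h; l] _ R4) => -[|[|[|[|]]]].
apply: (@rec_sum 4 (fun a => 2 ^ nth 0 a 2)%N (fun a => (nth 0 a 0).+1 ^ (nth 0 a 2).+1 *
   2 ^ (nth 0 a 4 * 2 ^ nth 0 a 1) <= 2 ^ (nth 0 a 3 * (nth 0 a 2).+1))%N).
  by apply: rec_exp; [exact: rec_const | exact: rec_nth].
by apply: rec_leq; do ?[exact: rec_nth | exact: rec_const | apply: rec_mul
  | apply: rec_exp | apply: rec_succ].
Qed.

(** Positions [0] to [6] hold [x, r, k, b, z, e, m], in the order in which [re_ex] will bind them;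
    [7] is the output [y], and [8] is kept for the [U]-program. *)
Lemma rec_search (Sd : nat -> nat -> bool) D :
  rec 2 (fun a => Sd (nth 0 a 0) (nth 0 a 1))%N ->
  rec 9 (fun a => search Sd D (nth 0 a 0) (nth 0 a 7) (nth 0 a 5) (nth 0 a 6)
    (nth 0 a 2) (nth 0 a 1) (nth 0 a 4) (nth 0 a 3))%N.
Proof.
move=> rS.
have rS' k i j : rec k (fun a => Sd (nth 0 a i) (nth 0 a j))%N.
  exact: (@rec_sub k [:: i; j] _ rS).
have rn k i : rec k (fun a => nlen (nth 0 a i))%N by apply: rec_nlen; exact: rec_nth.
have rv k i : rec k (fun a => (nth 0 a i).+1 - 2 ^ nlen (nth 0 a i))%N.
  apply: rec_subn; first by apply: rec_succ; exact: rec_nth.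
  by apply: rec_exp => //; exact: rec_const.
have rsum : rec 9 (fun a => \sum_(i < nth 0 a 2)
    Sd (nth 0 a 2) i * approx_count (nlen (nth 0 a 0))
      ((nth 0 a 0).+1 - 2 ^ nlen (nth 0 a 0)) (nth 0 a 1) (nlen i))%N.
  apply: (@rec_sum 9 (fun a => nth 0 a 2) (fun a => Sd (nth 0 a 3) (nth 0 a 0) *
    approx_count (nlen (nth 0 a 1)) ((nth 0 a 1).+1 - 2 ^ nlen (nth 0 a 1)) (nth 0 a 2)
     (nlen (nth 0 a 0))))%N; first exact: rec_nth.
  by apply: rec_mul => //; apply: rec_approx_count => //; exact: rec_nth.
rewrite /search; do !apply: rec_and;
  do ?[exact: rsum | exact: rv | exact: rn | exact: rS'
  | exact: rec_nth | exact: rec_const | apply: rec_neg | apply: rec_and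
  | apply: rec_leq | apply: rec_eq
  | apply: rec_mul | apply: rec_exp | apply: rec_succ | apply: rec_subn].
Qed.

Lemma ratr_decode (R : realType) e z b : (e.+1 = 2 ^ (2 * z) * (2 * b).+1)%N ->
  ratr (rat_decode e) = z%:R / b.+1%:R :> R.
Proof. by move=> /rat_decodeE ->; rewrite fmorph_div /= !ratr_nat. Qed.

Lemma search_sound (R : realType) (V : pfun) (T T1 B : R)
    (Sd : nat -> nat -> bool) D n v x y e m k r z b :
  0 < T -> T1 > 0 ->
  (forall u k (P : pred nat), T <= u -> u <= T1 ->
    \sum_(i < k | P i) (wt u i - wt T i) <= B * (u - T)) ->
  B <= 2 ^+ D -> Theta V T \is a fin_num ->
  (forall k i, Sd k i -> compr V i) ->
  nlen x = n -> (x.+1 = 2 ^ n + v)%N ->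
  v%:R <= 2 ^+ n * T -> 2 ^+ n * T <= v.+1%:R -> v.+1%:R / 2 ^+ n <= T1 ->
  fine (Theta V T) <= ratr (rat_decode e) ->
  search Sd D x y e m k r z b -> ~ compr V y.
Proof.
move=> T0 T10 HB BD Tfin SV xn xv vT Tv uT1 Te.
rewrite /search xn xv addKn => /and5P[_ /eqP eE zk yk /andP[yL _]] Vy.
have p0 j : (0 : R) < 2 ^+ j by rewrite exprn_gt0.
set u := v.+1%:R / 2 ^+ n in uT1.
have Tu : T <= u by rewrite ler_pdivlMr // mulrC.
have uT : u - T <= 2 ^- n.
  rewrite /u -natr1 mulrDl mul1r.
  have : v%:R / 2 ^+ n <= T by rewrite ler_pdivrMr // mulrC.
  lra.
(* The counts are floors, so the accepted integer inequality remains true of the exact weights. *)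
have {zk eE Te} TG : fine (Theta V T) < \sum_(i < k | Sd k i) wt u i.
  apply: (le_lt_trans Te); rewrite (ratr_decode _ eE) ltr_pdivrMr ?ltr0n //.
  rewrite -(ltr_pM2r (p0 r)) -natrX -natrM.
  move: zk; rewrite -(ltr_nat R) => /lt_le_trans; apply.
  rewrite natrM.
  rewrite [leRHS](_ : _ = b.+1%:R * (2 ^+ r * \sum_(i < k | Sd k i) wt u i));
    last by rewrite natrX; ring.
  rewrite ler_wpM2l ?ler0n // mulr_sumr natr_sum [leRHS]big_mkcond.
  apply: ler_sum => i _.
  rewrite natrM (@approx_countE R) -/u; case: (Sd k i); rewrite ?mul0r // mul1r truncn_le.
  by rewrite mulr_ge0 // ?ltW ?wt_gt0.
have Tlow : wt T y + \sum_(i < k | Sd k i) wt T i <= fine (Theta V T).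
  have := @Theta_ge R V T (y :: [seq i <- iota 0 k | Sd k i]) Tfin.
  rewrite big_cons big_filter -[in iota _ _](subn0 k) -/(index_iota _ _) big_mkord.
  apply.
    rewrite /= filter_uniq ?iota_uniq // andbT mem_filter mem_iota subn0 add0n /= andbC.
    exact: yk.
  move=> i; rewrite inE => /orP[/eqP->//|]; rewrite mem_filter => /andP[+ _]; exact: SV.
have := HB u k (Sd k) Tu uT1; rewrite sumrB => HBu.
have wy : wt T y < 2 ^+ D / 2 ^+ n.
  apply: (@lt_le_trans _ _ (B * (u - T))); first lra.
  by apply: (le_trans (ler_wpM2r _ BD)); rewrite ?subr_ge0 // ler_pM2l.
have [s [p [sy _ ps]]] := Vy.
have y0 : (0 < nlen y)%N by rewrite -sy nlen_code (leq_ltn_trans _ ps).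
(* Otherwise the truncated [n - D] is [0] and [y] codes the empty string, which has no shorter
   program. *)
have Dn : (D < n)%N.
  rewrite ltnNge; apply/negP => /eqP Dn0; move: yL; rewrite Dn0 muln0 leqn0 muln_eq0.
  by rewrite expn_eq0 /= orbF; case: (nlen y) y0.
move: wy; rewrite /wt -(subnKC (ltnW Dn)) exprD invfM mulrA divff ?gt_eqF // mul1r.
apply/negP; rewrite -leNgt -powR_invn //; apply: ler_powR; first by rewrite ler1n.
rewrite mulNr lerN2 ler_pdivrMr // -(ler_pM2r (p0 n)).
move: yL; rewrite -(ler_nat R) !natrM !natrX => /le_trans; apply.
rewrite [leRHS](_ : _ = (2 ^+ n * T) * (n - D)%:R); last by ring.
by rewrite ler_wpM2r ?ler0n.
Qed.

(** A finite [T]-sum is chosen to miss Theta by less than the gain [wt u i0 - wt T i0] of one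
    compressible [i0]; passing to [u] with [i0] included makes up the deficit. *)
Lemma Theta_lt_sum (R : realType) (V : pfun) (T u : R) (Sd : nat -> nat -> bool) :
  0 < T -> T < u -> Theta V T \is a fin_num ->
  (forall k k' i, (k <= k')%N -> Sd k i -> Sd k' i) ->
  (forall i, compr V i <-> exists k, Sd k i) ->
  (exists i, compr V i) ->
  exists k, fine (Theta V T) < \sum_(i < k | Sd k i) wt u i.
Proof.
move=> T0 Tu Tfin mS SV [i0 Vi0].
have u0 : 0 < u by exact: lt_trans Tu.
have i0n : (0 < nlen i0)%N.
  by have [s [p [<- _ ps]]] := Vi0; rewrite nlen_code (leq_ltn_trans _ ps).
have wTu i : wt T i <= wt u i.
  apply: ler_powR; first by rewrite ler1n.
  by rewrite !mulNr lerN2 ler_wpM2l ?ler0n // lef_pV2 // ltW.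
have w0 : wt T i0 < wt u i0.
  rewrite /wt /powR pnatr_eq0 /= ltr_expR ltr_pM2r ?ln_gt0 ?ltr1n //.
  by rewrite !mulNr ltrN2 ltr_pM2l ?ltr0n // ltf_pV2.
have [|l [ul lV lT]] :=
  @Theta_gt R V T (fine (Theta V T) - (wt u i0 - wt T i0)) Tfin; first lra.
have [l' [ul' lV' lT']] : exists l', [/\ uniq l', forall i, i \in l' -> compr V i &
     fine (Theta V T) < \sum_(i <- l') wt u i].
  have [il|il] := boolP (i0 \in l).
    exists l; split=> //.
    apply: (@lt_le_trans _ _ (\sum_(i <- l) wt T i + (wt u i0 - wt T i0)));
      first lra.
    rewrite !(bigD1_seq i0 il ul) /=.
    have : \sum_(i <- l | i != i0) wt T i <=
           \sum_(i <- l | i != i0) wt u i by exact: ler_sum.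
    lra.
  exists (i0 :: l); split; first by rewrite /= il.
    by move=> i; rewrite inE => /orP[/eqP->|/lV].
  rewrite big_cons.
  have : \sum_(i <- l) wt T i <= \sum_(i <- l) wt u i by exact: ler_sum.
  have := wt_gt0 T i0; lra.
have ex_stage i : exists k, i \in l' -> Sd k i.
  have [/lV'/SV[k ki]|_] := boolP (i \in l'); last by exists 0%N.
  by exists k.
have [h hP] := choice ex_stage.
(* Exceeds every listed code and reaches the stage at which each is enumerated. *)
pose k := \max_(i <- l') maxn i.+1 (h i).
have kP i : i \in l' -> (i < k)%N && Sd k i.
  move=> il; have : (maxn i.+1 (h i) <= k)%N by exact: leq_bigmax_seq.
  by rewrite geq_max => /andP[-> hk]; apply: mS hk (hP _ il).
exists k; apply: (lt_le_trans lT').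
rewrite -(big_mkord (fun i => Sd k i) (fun i => wt u i)) -big_filter.
rewrite [leRHS](bigID (mem l')) /=.
have E : perm_eq l' [seq i <- [seq i <- index_iota 0 k | Sd k i] | i \in l'].
  apply: uniq_perm => //; first by rewrite !filter_uniq // iota_uniq.
  move=> i; rewrite !mem_filter mem_index_iota leq0n /=.
  by have [/kP/andP[-> ->]|] := boolP (i \in l').
rewrite (perm_big _ E) big_filter lerDl sumr_ge0 // => i _.
by rewrite ltW ?wt_gt0.
Qed.

Lemma search_complete (R : realType) (V : pfun) (T : R) (Sd : nat -> nat -> bool)
    (f : nat -> rat) cf D n v x :
  0 < T -> T < v.+1%:R / 2 ^+ n -> Theta V T \is a fin_num ->
  (forall k k' i, (k <= k')%N -> Sd k i -> Sd k' i) ->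
  (forall i, compr V i <-> exists k, Sd k i) ->
  (exists i, compr V i) ->
  (forall m, (0 < m)%N -> exists e, eval cf [:: m] e /\ rat_decode e = f m) ->
  (forall m, (0 < m)%N -> fine (Theta V T) <= ratr (f m)) ->
  ((fun m => ratr (f m) : R) @ \oo --> fine (Theta V T))%classic ->
  nlen x = n -> (x.+1 = 2 ^ n + v)%N ->
  exists m e z b k r y, eval cf [:: m] e /\ search Sd D x y e m k r z b.
Proof.
move=> T0 Tu Tfin mS SV Vex cfP fge fcvg xn xv.
have [k kG] := Theta_lt_sum T0 Tu Tfin mS SV Vex.
set u := v.+1%:R / 2 ^+ n in Tu kG; set G := \sum_(i < k | _) _ in kG.
have [m [fm m0]] : exists m, ratr (f m) < G /\ (0 < m)%N.
  have : (\forall m \near \oo, ratr (f m) < G /\ (0 < m)%N)%classic.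
    near=> m; split; near: m; last exact: nbhs_infty_gt.
    exact: (cvgr_lt _ fcvg).
  by move=> /filter_ex[m ?]; exists m.
have [e [em ef]] := cfP m m0.
have [z [b ezb]] : exists z b, (e.+1 = 2 ^ (2 * z) * (2 * b).+1)%N.
  apply: rat_decode_ge0; rewrite ef -(@ler0q R).
  apply: le_trans (fge m m0); have := @Theta_ge R V T [::] Tfin isT.
  by rewrite big_nil; apply.
have fE : ratr (f m) = z%:R / b.+1%:R :> R by rewrite -ef; exact: ratr_decode.
(* Each of the [k] terms loses at most [2^-r] to truncation, so [k / 2^r] must stay below the gap
   [G - f m]. *)
have [r rG] : exists r, k%:R / (G - ratr (f m)) < 2 ^+ r.
  exists (Num.truncn (k%:R / (G - ratr (f m)))).+1.
  apply: (lt_le_trans (truncnS_gt _)); rewrite -natrX ler_nat.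
  by rewrite ltnW // ltn_expl.
(* This floor is the only length that the last two tests of [search] admit. *)
have [y [yL Vy]] := exists_incompressible V ((v * (n - D)) %/ 2 ^ n).
exists m, e, z, b, k, r, y; split=> //.
rewrite /search xn xv addKn m0 ezb eqxx yL leq_divM ltn_ceil ?expn_gt0 // !andbT /=.
apply/andP; split; last first.
  by apply/negP => /andP[_ Sy]; apply: Vy; apply/SV; exists k.
have cntG : 2 ^+ r * G - k%:R <=
    (\sum_(i < k) Sd k i * approx_count n v r (nlen i))%:R :> R.
  have -> : 2 ^+ r * G - k%:R =
      \sum_(i < k) (2 ^+ r * (if Sd k i then wt u i else 0) - 1).
    by rewrite sumrB -mulr_sumr -big_mkcond sumr_const card_ord.
  rewrite natr_sum; apply: ler_sum => i _; rewrite natrM (@approx_countE R) -/u.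
  case: (Sd k i); last by rewrite mulr0 mul0r sub0r oppr_le0.
  by rewrite mul1r lerBlDr natr1 ltW // truncnS_gt.
rewrite -(ltr_nat R) natrM natrX natrM.
have b0 : (0 : R) < b.+1%:R by rewrite ltr0n.
rewrite -(ltr_pM2l (_ : (0 : R) < b.+1%:R^-1)) ?invr_gt0 //.
rewrite mulrA mulrA mulVf ?gt_eqF // mul1r.
apply: lt_le_trans cntG; rewrite (mulrC _ z%:R) -fE.
move: rG; rewrite ltr_pdivrMr ?subr_gt0 //; lra.
Unshelve. all: by end_near.
Qed.

(** * From the bits of T to the complexity bound *)

Lemma bin_val_restr (R : realType) (T : R) n : 0 < T < 1 ->
  bin_val (restr T n) = (2 ^ n + Num.truncn (2 ^+ n * T))%N.
Proof.
move=> /andP[T0 T1].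
have fT : Num.floor T = 0 by apply/floor_def; rewrite ltW //= add0r.
have ge0 m : 0 <= 2 ^+ m * T by rewrite mulr_ge0 ?exprn_ge0 ?ltW.
elim: n => [|n IH].
  rewrite expr0 mul1r /restr /= (_ : Num.truncn T = 0%N) //.
  by apply: truncn_def; rewrite ltW.
have iS : iota 0 n.+1 = rcons (iota 0 n) n by rewrite -addn1 iotaD cats1.
rewrite /restr iS map_rcons bin_val_rcons -/(restr T n) IH fT subr0.
rewrite -[X in odd X](_ : Num.truncn (2 ^+ n.+1 * T) = _); last first.
  by rewrite truncn_floor ge0.
(* The new bit is the parity of [w], and the previous prefix has value [w./2]. *)
set w := Num.truncn (2 ^+ n.+1 * T).
rewrite (_ : Num.truncn (2 ^+ n * T) = w./2); first by rewrite expnS; lia.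
have /andP[w1 w2] := truncn_itv (ge0 n.+1); rewrite -/w in w1 w2.
have wE : w%:R = (odd w)%:R + 2 * (w./2)%:R :> R.
  by rewrite -[in LHS](odd_double_half w) natrD -mul2n natrM.
have o0 : 0 <= (odd w)%:R :> R by rewrite ler0n.
have o1 : (odd w)%:R <= 1 :> R by rewrite lern1; case: odd.
apply: truncn_def; move: w1 w2; rewrite exprS -!natr1 wE => w1 w2.
by apply/andP; split; lra.
Qed.

Lemma restr_code (R : realType) (T : R) n : 0 < T < 1 ->
  [/\ nlen (str_code (restr T n)) = n &
      (str_code (restr T n)).+1 = (2 ^ n + Num.truncn (2 ^+ n * T))%N].
Proof.
by move=> T01; rewrite nlen_code str_codeS bin_val_restr // size_map size_iota.
Qed.

Lemma re_compr V : partial_recursive V -> re 1 (fun a => compr V (nth 0%N a 0)).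
Proof.
move=> [c cP].
have := @re_ex 1 (fun a => eval c [:: nth 0 a 0] (nth 0 a 1) /\
                           (nlen (nth 0 a 0) < nlen (nth 0 a 1))%N)%N.
move=> H; apply: re_ext (H _).
  move=> a _ /=; split=> [[p [ep lp]]|[s [p [<- /cP Vp ps]]]]; last first.
    by exists (str_code p); rewrite !nlen_code.
  have [q qp] := str_code_surj p; have [s sa] := str_code_surj (nth 0%N a 0).
  exists s, q; split=> //; first by apply/cP; rewrite qp sa.
  by move: lp; rewrite -qp -sa !nlen_code.
apply: re_and; first by apply: re_eval; exact: rec_nth.
apply: re_dec; apply: rec_leq; first by apply: rec_succ; apply: rec_nlen; exact: rec_nth.
by apply: rec_nlen; exact: rec_nth.
Qed.

Theorem theorem10 (R : realType) (U V : pfun) (T : R) :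
  optimal U -> optimal V -> 0 < T < 1 ->
  Theta V T \is a fin_num -> right_computable (fine (Theta V T)) ->
  weakly_Chaitin_random U T T.
Proof.
move=> optU optV T01 Tfin [f [[cf cfP] [fge fcvg]]].
have [T0 T1] := andP T01.
have [[[cU UP] Upf] _] := optU; have [[recV _] Vopt] := optV.
have [Sd [rS mS SV]] := re_stages (re_compr recV).
have Vex : exists i, compr V i.
  have [s [p [Vp ps]]] := optimal_compresses optV.
  by exists (str_code s), s, p.
pose S := (1 + T) / 2.
have TS : T < S by rewrite /S; lra.
have S1 : S < 1 by rewrite /S; lra.
have [B HB] := wt_diff_sum T0 TS S1.
have [D BD] : exists D, B <= 2 ^+ D.
  exists (Num.truncn B).+1; rewrite ltW // (lt_le_trans (truncnS_gt _)) //.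
  by rewrite -natrX ler_nat ltnW // ltn_expl.
(* From [n0] on, [2^-n <= S - T] and hence [u <= S]; smaller [n] are absorbed by the final
   constant. *)
have [n0 n0S] : exists n0, (S - T)^-1 <= 2 ^+ n0.
  exists (Num.truncn (S - T)^-1).+1; rewrite ltW // (lt_le_trans (truncnS_gt _)) //.
  by rewrite -natrX ler_nat ltnW // ltn_expl.
pose A a := exists m e z b k r x,
  [/\ eval cU [:: nth 0 a 1] x, eval cf [:: m] e &
      search Sd D x (nth 0 a 0) e m k r z b]%N.
have /re_machine[C [recC CA AC]] : re 2 A.
  have /re_ex/re_ex/re_ex/re_ex/re_ex/re_ex/re_ex : re 9 (fun a =>
    eval cU [:: nth 0 a 8] (nth 0 a 0) /\ (eval cf [:: nth 0 a 6] (nth 0 a 5) /\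
    search Sd D (nth 0 a 0) (nth 0 a 7) (nth 0 a 5) (nth 0 a 6)
      (nth 0 a 2) (nth 0 a 1) (nth 0 a 4) (nth 0 a 3)))%N.
    by do 2![apply: re_and; first by apply: re_eval; exact: rec_nth];
      apply: re_dec; exact: rec_search.
  apply: re_ext => a _ /=; rewrite /A; split.
    by move=> [m [e [z [b [k [r [x [? [? ?]]]]]]]]]; exists m, e, z, b, k, r, x.
  by move=> [m [e [z [b [k [r [x [? ? ?]]]]]]]]; exists m, e, z, b, k, r, x.
have Cdom p : dom C p -> dom U p.
  rewrite /dom /=; case Cp: (C p) => [s|] // _.
  have [m [e [z [b [k [r [x [/= ex _ _]]]]]]]] := CA _ _ Cp.
  by have [t tx] := str_code_surj x; rewrite -tx in ex; move/UP: ex => ->.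
have [|d dP] := Vopt C.
  by split=> // p q /Cdom Up /Cdom Uq; exact: Upf.
(* [n0] covers short prefixes, [D] the loss [T * D], and [d] the passage from [C] to [V]. The [2]
   pays for rounding the output length and for replacing [v / 2^n] by [T]. *)
exists (n0 + D + 2 + d)%N => n _.
apply: le_ereal_inf_tmp => _ [p /= Up <-]; rewrite lee_fin.
have [nn0|n0n] := ltnP n n0.
  apply: (@le_trans _ _ 0); last by rewrite ler0n.
  rewrite subr_le0 (@le_trans _ _ n%:R) ?ler_piMl ?ler0n ?(ltW T1) //.
  by rewrite ler_nat -!addnA (leq_trans (ltnW nn0)) ?leq_addr.
have [xn xv] := restr_code n T01.
set x := str_code (restr T n) in xn xv; set v := Num.truncn _ in xv.
have p0 : (0 : R) < 2 ^+ n by rewrite exprn_gt0.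
have /andP[v1 v2] : v%:R <= 2 ^+ n * T < v.+1%:R.
  by apply: truncn_itv; rewrite mulr_ge0 // ltW.
have Tu : T < v.+1%:R / 2 ^+ n by rewrite ltr_pdivlMr // mulrC.
have uS : v.+1%:R / 2 ^+ n <= S.
  rewrite -natr1 mulrDl mul1r.
  have : v%:R / 2 ^+ n <= T by rewrite ler_pdivrMr // mulrC.
  have : 2 ^- n <= S - T.
    rewrite -[leRHS]invrK lef_pV2 ?posrE ?invr_gt0 ?subr_gt0 //.
    by apply: le_trans n0S _; rewrite ler_eXn2l // ltr1n.
  lra.
have SV' k i : Sd k i -> compr V i by move=> ki; apply/(SV i); exists k.
have Cp : C p <> None.
  have [m [e [z [b [k [r [y [em sy]]]]]]]] :=
    search_complete D T0 Tu Tfin mS SV Vex cfP fge fcvg xn xv.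
  have [s ys] := str_code_surj y.
  apply: (AC p y); exists m, e, z, b, k, r, x; split=> //=.
  exact/UP.
case CpE : (C p) Cp => [s|] // _.
(* The actual output [s] may differ from the string found by completeness, so its own witnesses are
   extracted before soundness is applied. *)
have [m [e [z [b [k [r [x' [/= ex em sy]]]]]]]] := CA _ _ CpE.
have xx' : x' = x by apply: eval_fun ex _; apply/UP.
rewrite xx' in sy => {xx' ex}.
have m0 : (0 < m)%N by case/andP: sy.
have Te : fine (Theta V T) <= ratr (rat_decode e).
  have [e' [em' fe']] := cfP m m0.
  by rewrite -(eval_fun em' em) fe' fge.
have nV := search_sound T0 (lt_trans T0 TS) HB BD Tfin SV' xn xv v1 (ltW v2) uS Te sy.
have [|q [_ [Vq pq]]] := dP p; first by rewrite /dom /= CpE.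
(* Otherwise the [V]-program [q] for [s] would be shorter than [s], against its
   incompressibility. *)
have sp : (size s <= size p + d)%N.
  apply: leq_trans pq; rewrite leqNgt; apply/negP => qs; apply: nV.
  by exists s, q; split=> //; rewrite Vq.
move: sy; rewrite /search xn xv addKn nlen_code => /and5P[_ _ _ _ /andP[_]].
rewrite -(ltr_nat R) !natrM natrX -ltr_pdivrMr // mulrAC => vs.
have {}sp : (size s)%:R <= (size p)%:R + d%:R :> R by rewrite -natrD ler_nat.
have vT : T - 2 ^- n <= v%:R / 2 ^+ n.
  by move: Tu; rewrite -natr1 mulrDl mul1r; lra.
have nD : n%:R - D%:R <= (n - D)%:R :> R.
  by rewrite lerBlDr -natrD ler_nat addnC -leq_subLR.
have nDn : (n - D)%:R * 2 ^- n <= 1 :> R.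
  rewrite ler_pdivrMr // mul1r -natrX ler_nat.
  by rewrite (leq_trans (leq_subr D n)) // ltnW // ltn_expl.
have h1 : (T - 2 ^- n) * (n - D)%:R <= v%:R / 2 ^+ n * (n - D)%:R.
  by rewrite ler_wpM2r ?ler0n.
have h2 : T * (n%:R - D%:R) <= T * (n - D)%:R by rewrite ler_pM2l.
have h3 : T * D%:R <= D%:R by rewrite ler_piMl ?ler0n // ltW.
have h4 : 0 <= n0%:R :> R by rewrite ler0n.
move: vs; rewrite -(natr1 (size s)) => vs.
rewrite !natrD; move: h1 h2 nDn; rewrite mulrBl mulrBr (mulrC (2 ^- n)); lra.
Qed.
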